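(* Let $\boldsymbol{\pi}\in\mathbb{R}^n$ be a vector with positive entries such that $\boldsymbol{\pi}^T\mathbf{1}=1$, and let $S\in\mathbb{S}_n^{\boldsymbol{\pi}}$. The orthogonal complement in $\mathbb{R}^{n\times n}$, with respect to the Fisher inner product $\langle\cdot,\cdot\rangle_S$, of the tangent space $\mathcal{T}_S \mathbb{S}_n^{\boldsymbol{\pi}}$ is $$\mathcal{T}_S^\perp \mathbb{S}_n^{\boldsymbol{\pi}} = \{ \xi_S^\perp \in \mathbb{R}^{n\times n} : \xi_S^\perp = (\boldsymbol{\alpha} \mathbf{1}^T + \boldsymbol{\pi} \boldsymbol{\beta}^T) \odot S \ \text{ for some vectors } \boldsymbol{\alpha},\boldsymbol{\beta} \in \mathbb{R}^{n}\}.$$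
   Context: $\mathbf{1}=(1,\ldots,1)^T\in\mathbb{R}^n$; $\odot$ and $\oslash$ denote entrywise (Hadamard) multiplication and division; $S>0$ means all entries are positive. $\mathbb{S}_n^{\boldsymbol{\pi}} = \{ S \in \mathbb{R}^{n \times n} : S \mathbf{1} = \mathbf{1},\ \boldsymbol{\pi}^T S = \boldsymbol{\pi}^T,\ S > 0 \}$ is an embedded submanifold of $\mathbb{R}^{n\times n}$ whose tangent space at $S$ is $\mathcal{T}_S \mathbb{S}_n^{\boldsymbol{\pi}} = \{ \xi \in \mathbb{R}^{n \times n} : \xi \mathbf{1} = \mathbf{0},\ \boldsymbol{\pi}^T \xi = \mathbf{0}^T \}$. The Fisher inner product at $S$ is $\langle \xi,\eta\rangle_S=\sum_{i,j=1}^n \frac{\xi_{i,j}\eta_{i,j}}{S_{i,j}}=\operatorname{Trace}((\xi\oslash S)\eta^T)$ for $\xi,\eta\in\mathbb{R}^{n\times n}$. *)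

(* Defs.v *)
From mathcomp Require Import all_boot all_order all_algebra.
From mathcomp Require Import classical_sets reals.
Set Implicit Arguments.
Unset Strict Implicit.
Unset Printing Implicit Defensive.
Import Order.TTheory GRing.Theory Num.Theory.
Local Open Scope ring_scope.
Local Open Scope classical_set_scope.

Definition hadamard_mul (R : realType) (m n : nat) (A B : 'M[R]_(m, n)) :
  'M[R]_(m, n) := map2_mx (fun x y => x * y) A B.

Definition hadamard_div (R : realType) (m n : nat) (A B : 'M[R]_(m, n)) :
  'M[R]_(m, n) := map2_mx (fun x y => x / y) A B.

Notation "A .* B" := (hadamard_mul A B) (at level 40, left associativity).
Notation "A ./ B" := (hadamard_div A B) (at level 40, left associativity).

Definition ones (R : realType) (n : nat) : 'cV[R]_n := const_mx 1.
Arguments ones {R n}.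

Definition stoch_manifold (R : realType) (n : nat) (p : 'cV[R]_n) :
    set 'M[R]_n :=
  [set S | [/\ S *m ones = ones, p^T *m S = p^T & forall i j, 0 < S i j]].

(* The tangent space does not depend on the foot point [S]. *)
Definition tangent_space (R : realType) (n : nat) (p : 'cV[R]_n)
    (S : 'M[R]_n) : set 'M[R]_n :=
  [set X | X *m ones = 0 /\ p^T *m X = 0].

Definition fisher (R : realType) (n : nat) (S X Y : 'M[R]_n) : R :=
  \sum_(i < n) \sum_(j < n) X i j * Y i j / S i j.

Lemma fisher_trace (R : realType) (n : nat) (S X Y : 'M[R]_n) :
  fisher S X Y = \tr ((X ./ S) *m Y^T).
Proof.
rewrite /fisher /mxtrace; apply: eq_bigr => i _; rewrite mxE.
by apply: eq_bigr => j _; rewrite !mxE mulrAC.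
Qed.

Definition orth_compl (R : realType) (V : Type) (dot : V -> V -> R)
    (A : set V) : set V :=
  [set y | forall x, A x -> dot x y = 0].

Definition normal_space (R : realType) (n : nat) (p : 'cV[R]_n)
    (S : 'M[R]_n) : set 'M[R]_n :=
  orth_compl (fisher S) (tangent_space p S).

(* Main.v *)
Require Import Defs.
From mathcomp Require Import all_boot all_order all_algebra.
From mathcomp Require Import classical_sets reals.
Import Order.TTheory GRing.Theory Num.Theory.
Local Open Scope ring_scope.
Local Open Scope classical_set_scope.

(** Writing [Z := Y ./ S], the Fisher product of [X] and [Y] at [S] is the
    Frobenius product [\tr (X *m Z^T)] ([fisher_frobenius]), so the claim is
    that the Frobenius orthogonal of the tangent space is the set of matrices
    [alpha *m ones^T + p *m beta^T].

    Such matrices are orthogonal to every tangent [X], since [X *m ones = 0]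
    and [p^T *m X = 0].  Conversely, [J := 1%:M - ones *m p^T] satisfies
    [J *m ones = 0] and [p^T *m J = 0] because [p^T *m ones = 1%:M], so
    [J *m W *m J] is tangent for every [W] ([tangent_sandwich]).  Moving both
    factors [J] to the other side of the Frobenius product, a normal [Y] makes
    [J^T *m Z *m J^T] orthogonal to every [W], in particular to itself; hence
    it vanishes ([mxtrace_mul_tr_eq0]), and expanding the products solves for
    [Z] in the required form. *)

Lemma fisher_frobenius (R : realType) (n : nat) (S X Y : 'M[R]_n) :
  fisher S X Y = \tr (X *m (Y ./ S)^T).
Proof.
rewrite /fisher /mxtrace; apply: eq_bigr => i _; rewrite mxE.
by apply: eq_bigr => j _; rewrite !mxE mulrA.
Qed.

Lemma mxtrace_mul_tr_eq0 (R : realDomainType) (m n : nat) (A : 'M[R]_(m, n)) :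
  \tr (A *m A^T) = 0 -> A = 0.
Proof.
have sq_ge0 i j : 0 <= A i j * A^T j i by rewrite mxE -expr2 sqr_ge0.
move=> trA0; apply/matrixP => i j.
have rowA0 : (A *m A^T) i i = 0.
  by apply: (psumr_eq0P _ trA0) => // k _; rewrite mxE sumr_ge0.
rewrite mxE in rowA0.
have /eqP : A i j * A^T j i = 0 by apply: (psumr_eq0P _ rowA0).
by rewrite !mxE mulf_eq0 orbb => /eqP.
Qed.

Lemma hadamard_mulK (R : realType) (m n : nat) (A S : 'M[R]_(m, n)) :
  (forall i j, S i j != 0) -> (A .* S) ./ S = A.
Proof. by move=> S_neq0; apply/matrixP => i j; rewrite !mxE mulfK. Qed.

Lemma hadamard_divK (R : realType) (m n : nat) (A S : 'M[R]_(m, n)) :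
  (forall i j, S i j != 0) -> (A ./ S) .* S = A.
Proof. by move=> S_neq0; apply/matrixP => i j; rewrite !mxE divfK. Qed.

Lemma tangent_sandwich (R : realType) (n : nat) (p : 'cV[R]_n) (S W : 'M[R]_n) :
  p^T *m ones = 1%:M ->
  tangent_space p S ((1%:M - ones *m p^T) *m W *m (1%:M - ones *m p^T)).
Proof.
move=> p_sum; set J := 1%:M - _.
have J1 : J *m ones = 0 by rewrite mulmxBl mul1mx -mulmxA p_sum mulmx1 subrr.
have pJ : p^T *m J = 0 by rewrite mulmxBr mulmx1 mulmxA p_sum mul1mx subrr.
by split; [rewrite -!mulmxA J1 !mulmx0 | rewrite !mulmxA pJ !mul0mx].
Qed.

Theorem lemma4p2 (R : realType) (n : nat) (p : 'cV[R]_n)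
    (p_gt0 : forall i, 0 < p i 0) (p_sum : p^T *m ones = 1%:M)
    (S : 'M[R]_n) (hS : stoch_manifold p S) :
  normal_space p S =
  [set X : 'M[R]_n | exists alpha beta : 'cV[R]_n,
     X = (alpha *m ones^T + p *m beta^T) .* S].
Proof.
have S_neq0 i j : S i j != 0 by case: hS => _ _ S_gt0; rewrite gt_eqF.
apply/seteqP; split => [Y normalY | _ [alpha [beta ->]] X [X1 pX]]; last first.
  rewrite fisher_frobenius hadamard_mulK // linearD /= !trmx_mul !trmxK.
  rewrite mulmxDr mxtraceD !mulmxA X1 mul0mx mxtrace0 add0r.
  by rewrite mxtrace_mulC mulmxA pX mul0mx mxtrace0.
pose Z := Y ./ S.
pose J : 'M[R]_n := 1%:M - ones *m p^T.
pose Q := J^T *m Z *m J^T.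
have Q0 : Q = 0.
  apply: mxtrace_mul_tr_eq0.
  rewrite -(normalY _ (tangent_sandwich _ _ _ S Q p_sum)).
  rewrite fisher_frobenius -/Z -/J /Q !trmx_mul !trmxK -!mulmxA.
  by rewrite [RHS]mxtrace_mulC !mulmxA.
(* [J^T = 1%:M - p *m ones^T], so [Q] is [Z] minus a matrix of the sought form. *)
exists (Z *m p - p *m (ones^T *m Z *m p)), (Z^T *m ones).
rewrite -[LHS](@hadamard_divK _ _ _ Y S) // -/Z; congr (_ .* S).
apply/eqP; rewrite -subr_eq0 -Q0 /Q /J; apply/eqP.
rewrite linearB /= trmx1 !trmx_mul !trmxK.
rewrite !(mulmxBl, mulmxBr) !mul1mx !mulmx1 !mulmxA.
by rewrite opprD opprD [in LHS]addrA [RHS]addrAC.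
Qed.
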